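(* There is a unique family $(\Gamma_z)_{z\in\mathbb Z}$ of maps $\Gamma_z\colon F\mathbb Z\to F\mathbb Z$ satisfying the three axioms \begin{align*} \Gamma_z() &= () && \text{for all } z\in\mathbb Z,\\ \Gamma_z(b) &= (z^b) && \text{for all } z,b\in\mathbb Z,\\ \Gamma_z(v\ast w) &= \Gamma_z v\ast \Gamma_{z+\# v}\,w && \text{for all } z\in\mathbb Z,\ v,w\in F\mathbb Z. \end{align*}
   Context: $(F\mathbb Z,\ast)$ denotes the free group on the set $\mathbb Z$ of integers; its elements are called words and are written as parenthesised finite formal power products $(b_1^{m_1}\dots b_k^{m_k})$ with $k\in\mathbb N_0$, bases $b_1,\dots,b_k\in\mathbb Z$ (the free generators) and exponents $m_1,\dots,m_k\in\mathbb Z$. The empty word $()$ is the identity element, and $\ast$ is concatenation subject only to the reduction rules $(b^m)\ast(b^n)=(b^mb^n)=(b^{m+n})$ and $(b^0)=()$ for $b,m,n\in\mathbb Z$. Powers are formal (they are not evaluated as integers), and $(b)$ abbreviates $(b^1)$. Thus $(z^b)$ is the $b$-th power of the generator $z$. The length $\#\colon(F\mathbb Z,\ast)\to(\mathbb Z,+)$ is the group homomorphism with $\#(b_1^{m_1}\dots b_k^{m_k})=m_1+\dots+m_k$. *)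

(* Defs.v *)
From HB Require Import structures.
From mathcomp Require Import all_boot all_order all_algebra.
Set Implicit Arguments. Unset Strict Implicit. Unset Printing Implicit Defensive.
Import GRing.Theory.
Local Open Scope ring_scope.

(* The free group on [T]: its elements are the reduced formal power products
   [:: (b_1, m_1); ..; (b_k, m_k)], with nonzero exponents and distinct
   adjacent bases. *)
Section FreeGroup.
Variable T : choiceType.
Implicit Types (x : T * int) (s u v w : seq (T * int)).

Definition reduced s : bool :=
  all (fun x => x.2 != 0) s && sorted (fun x y => x.1 != y.1) s.

Record freeGroup : Type := Word { syllables :> seq (T * int); _ : reduced syllables }.

HB.instance Definition _ := [isSub for syllables].
HB.instance Definition _ := [Choice of freeGroup by <:].

(* Reduced form of (b^m) * s, for x = (b, m) and s reduced. *)
Definition cons_red x s : seq (T * int) :=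
  if x.2 == 0 then s else
  if s is y :: s' then
    if x.1 == y.1 then
      if x.2 + y.2 == 0 then s' else (x.1, x.2 + y.2) :: s'
    else x :: s
  else [:: x].

Lemma reduced_behead x s : reduced (x :: s) -> reduced s.
Proof.
rewrite /reduced /= => /andP[/andP[_ ->]].
by case: s => //= y s /andP[].
Qed.

Lemma reduced_cons_red x s : reduced s -> reduced (cons_red x s).
Proof.
move=> rs; rewrite /cons_red; case: (eqVneq x.2 0) => // x0.
case: s rs => [|y s] rs; first by rewrite /reduced /= x0.
have := rs; rewrite /reduced /= => /andP[/andP[y0 ss] ps].
case: (eqVneq x.1 y.1) => [exy|nxy]; last by rewrite /= x0 y0 ss nxy.
case: (eqVneq (x.2 + y.2) 0) => [_|xy0].
  exact: (reduced_behead rs).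
by rewrite /= xy0 ss /=; case: s ps {rs ss} => //= z s; rewrite exy.
Qed.

Lemma reduced_foldr u v : reduced v -> reduced (foldr cons_red v u).
Proof. by move=> rv; elim: u => //= x u; apply: reduced_cons_red. Qed.

Lemma cons_red0 b s : cons_red (b, 0) s = s.
Proof. by rewrite /cons_red eqxx. Qed.

Lemma cons_red_reduced x s : reduced (x :: s) -> cons_red x s = x :: s.
Proof.
rewrite /reduced /cons_red /= => /andP[/andP[/negPf -> _]].
by case: s => //= y s /andP[/negPf ->].
Qed.

Lemma cons_redD b m n s : reduced s ->
  cons_red (b, m) (cons_red (b, n) s) = cons_red (b, m + n) s.
Proof.
move=> rs; have [->|m0] := eqVneq m 0; first by rewrite cons_red0 add0r.
have [->|n0] := eqVneq n 0; first by rewrite cons_red0 addr0.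
case: s rs => [|[c k] s] rs.
  by rewrite /cons_red /= (negPf m0) (negPf n0) /= eqxx.
have := rs; rewrite {1}/reduced /= => /andP[/andP[k0 _] _].
have [eq_bc|nbc] := eqVneq b c; last first.
  by rewrite /cons_red /= (negPf m0) (negPf n0) (negPf nbc) /= ?eqxx.
subst c; have [nk0|nk0] := eqVneq (n + k) 0; last first.
  rewrite /cons_red /= (negPf m0) (negPf n0) eqxx (negPf nk0) eqxx addrA.
  by have [mn0|//] := eqVneq (m + n) 0; rewrite mn0 add0r (negPf k0).
have rms : reduced ((b, m) :: s).
  by move: rs; rewrite /reduced /= k0 m0; case: (s).
rewrite {2}/cons_red /= (negPf n0) eqxx nk0 eqxx cons_red_reduced //.
rewrite /cons_red /= eqxx -[m + n + k]addrA nk0 addr0 (negPf m0).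
have [mn0|//] := eqVneq (m + n) 0.
by rewrite -[k]add0r -mn0 -addrA nk0 addr0.
Qed.

Lemma foldr_cons_red x v w : reduced w ->
  foldr cons_red w (cons_red x v) = cons_red x (foldr cons_red w v).
Proof.
move=> rw; case: x => b m; have [->|m0] := eqVneq m 0; first by rewrite !cons_red0.
case: v => [|[c n] v]; rewrite [in LHS]/cons_red /= (negPf m0) //.
have [<-|//] := eqVneq b c; rewrite cons_redD; last exact: reduced_foldr.
by have [->|//] := eqVneq (m + n) 0; rewrite cons_red0.
Qed.

Lemma foldr_reduced u : reduced u -> foldr cons_red [::] u = u.
Proof.
elim: u => //= x u IH rxu.
by rewrite IH ?cons_red_reduced //; apply: reduced_behead rxu.
Qed.

Lemma foldr_cons_redA u v w : reduced w ->
  foldr cons_red (foldr cons_red w v) u = foldr cons_red w (foldr cons_red v u).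
Proof. by move=> rw; elim: u => //= x u ->; rewrite foldr_cons_red. Qed.

Definition inv_syl s : seq (T * int) := rev [seq (x.1, - x.2) | x <- s].

Lemma reduced_inv s : reduced s -> reduced (inv_syl s).
Proof.
rewrite /reduced /inv_syl all_rev rev_sorted => /andP[a0 ps]; apply/andP; split.
  by rewrite all_map; apply: sub_all a0 => x /=; rewrite oppr_eq0.
rewrite sorted_map; apply: sub_sorted ps => x y /=.
by rewrite eq_sym.
Qed.

Lemma inv_sylK : involutive inv_syl.
Proof.
move=> s; rewrite /inv_syl map_rev revK -map_comp -[RHS]map_id.
by apply: eq_map => -[b m] /=; rewrite opprK.
Qed.

Lemma foldr_inv s : reduced s -> foldr cons_red s (inv_syl s) = [::].
Proof.
elim: s => //= -[b m] s IH rs; rewrite /inv_syl /= rev_cons foldr_rcons.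
rewrite -(cons_red_reduced rs) cons_redD ?addNr ?cons_red0 ?IH //;
  exact: reduced_behead rs.
Qed.

(* The group element (b_1^{m_1} .. b_k^{m_k}) for an arbitrary formal power
   product, reduced or not. *)
Definition word s : freeGroup := Word (@reduced_foldr s [::] isT).

Definition mul_fg (v w : freeGroup) : freeGroup :=
  Word (reduced_foldr v (valP w)).
Definition inv_fg (v : freeGroup) : freeGroup := Word (reduced_inv (valP v)).

Fact mul_fgA : associative mul_fg.
Proof. by move=> u v w; apply: val_inj; apply: foldr_cons_redA (valP w). Qed.

Fact mul1_fg : left_id (word [::]) mul_fg.
Proof. by move=> v; apply: val_inj. Qed.

Fact mul_fg1 : right_id (word [::]) mul_fg.
Proof. by move=> v; apply: val_inj; apply: foldr_reduced (valP v). Qed.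

Fact mulV_fg : left_inverse (word [::]) inv_fg mul_fg.
Proof. by move=> v; apply: val_inj; apply: foldr_inv (valP v). Qed.

Fact mul_fgV : right_inverse (word [::]) inv_fg mul_fg.
Proof.
move=> v; apply: val_inj.
by have := foldr_inv (reduced_inv (valP v)); rewrite inv_sylK.
Qed.

HB.instance Definition _ :=
  isGroup.Build freeGroup mul_fgA mul1_fg mul_fg1 mulV_fg mul_fgV.

(* (b^m), the m-th power of the free generator (b) = (b^1) *)
Definition gpow (b : T) (m : int) : freeGroup := word [:: (b, m)].
Definition gen (b : T) : freeGroup := gpow b 1.

Definition wlength (w : freeGroup) : int := \sum_(x <- syllables w) x.2.

Lemma word_nil : word [::] = 1%g. Proof. by []. Qed.

Lemma word_cat u v : word (u ++ v) = (word u * word v)%g.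
Proof.
apply: val_inj; rewrite /= foldr_cat.
exact: (foldr_cons_redA u [::] (@reduced_foldr v [::] isT)).
Qed.

Lemma wordK (w : freeGroup) : word w = w.
Proof. by apply: val_inj; apply: foldr_reduced (valP w). Qed.

Lemma gpow0 b : gpow b 0 = 1%g.
Proof. by apply: val_inj; rewrite /= cons_red0. Qed.

Lemma gpowD b m n : gpow b (m + n) = (gpow b m * gpow b n)%g.
Proof. by rewrite /gpow -word_cat; apply: val_inj; rewrite /= cons_redD. Qed.

Lemma gpow_nat b (n : nat) : gpow b n = (gen b ^+ n)%g.
Proof. by elim: n => [|n IH]; rewrite ?gpow0 // expgS -IH -gpowD. Qed.

Lemma gpowN b m : gpow b (- m) = ((gpow b m)^-1)%g.
Proof. by apply/esym/mulg1_eq; rewrite -gpowD subrr gpow0. Qed.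

Lemma sum_cons_red x s :
  \sum_(y <- cons_red x s) y.2 = x.2 + \sum_(y <- s) y.2.
Proof.
rewrite /cons_red; have [->|x0] := eqVneq x.2 0; first by rewrite add0r.
case: s => [|y s]; rewrite ?big_cons //.
case: eqP => _; rewrite ?big_cons //.
by case: eqP => [xy0|_]; rewrite ?big_cons addrA // xy0 add0r.
Qed.

Lemma wlength_word s : wlength (word s) = \sum_(x <- s) x.2.
Proof.
rewrite /wlength /=; elim: s => //= x s IH.
by rewrite sum_cons_red IH big_cons.
Qed.

Lemma wlengthM (v w : freeGroup) : wlength (v * w)%g = wlength v + wlength w.
Proof.
by rewrite -{1}[v]wordK -{1}[w]wordK -word_cat wlength_word big_cat.
Qed.

Lemma freeGroup_ind (P : freeGroup -> Prop) :
  P 1%g -> (forall b (w : freeGroup), P w -> P (gen b * w)%g) ->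
  (forall b (w : freeGroup), P w -> P ((gen b)^-1 * w)%g) -> forall w : freeGroup, P w.
Proof.
move=> P1 PM PV w; rewrite -[w]wordK; elim: (syllables w) => // -[b m] s.
rewrite -cat1s word_cat -/(gpow b m); move: (word s) => v {s w} Pv.
case: m => n; last rewrite NegzE gpowN gpow_nat -expVgn.
  by rewrite gpow_nat; elim: n => [|n IH]; rewrite ?mul1g // expgS -mulgA; apply: PM.
by elim: n.+1 => [|k IH]; rewrite ?mul1g // expgS -mulgA; apply: PV.
Qed.

Lemma freeGroup_universal (G : groupType) (f : T -> G) :
  exists h : freeGroup -> G,
    [/\ {morph h : v w / (v * w)%g}, forall b, h (gen b) = f b
      & forall h' : freeGroup -> G, {morph h' : v w / (v * w)%g} ->
          (forall b, h' (gen b) = f b) -> h' =1 h].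
Proof.
pose e (x : G) (m : int) := (match m with Posz n => x ^+ n | Negz n => x ^- n.+1 end)%g.
have eV (x : G) (n : nat) : e x (- n%:Z) = (x ^- n)%g.
  by case: n => [|n]; [rewrite oppr0 /= invg1 | rewrite -NegzE].
have eS (x : G) m : e x (1 + m) = (x * e x m)%g.
  case: m => n; first by rewrite /= expgS.
  have -> : 1 + Negz n = - n%:Z.
    by rewrite NegzE -addn1 PoszD opprD addrCA subrr addr0.
  by rewrite eV /= expgSr invgM mulVKg.
have eN (x : G) m : e x (m - 1) = (x^-1 * e x m)%g.
  by rewrite -{2}[m](subrK 1) [_ - 1 + 1]addrC eS mulKg.
have eD (x : G) m n : e x (m + n) = (e x m * e x n)%g.
  elim/int_rec: m => [|m IH|m IH]; first by rewrite add0r mul1g.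
    by rewrite -addn1 PoszD [_ + 1]addrC -addrA !eS IH mulgA.
  by rewrite -addn1 PoszD opprD addrAC !eN IH mulgA.
pose h s := foldr (fun x g => (e (f x.1) x.2 * g)%g) 1%g s.
have hc x s : h (cons_red x s) = (e (f x.1) x.2 * h s)%g.
  rewrite /cons_red; have [->|x0] := eqVneq x.2 0; first by rewrite mul1g.
  case: s => [|y s] //=; case: eqP => //= ->; rewrite mulgA -eD.
  by case: eqP => //= ->; rewrite mul1g.
pose H (w : freeGroup) := h w.
have HM : {morph H : v w / (v * w)%g}.
  move=> v w; rewrite /H /=; elim: (syllables v) => /= [|x s IH].
    by rewrite mul1g.
  by rewrite hc IH mulgA.
have Hg b : H (gen b) = f b by rewrite /H /= mulg1.
exists H; split=> // h' h'M h'g.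
have m1 (k : freeGroup -> G) : {morph k : v w / (v * w)%g} -> k 1%g = 1%g.
  by move=> kM; apply: (@mulgI _ (k 1%g)); rewrite -kM !mulg1.
have mV (k : freeGroup -> G) (v : freeGroup) :
    {morph k : v w / (v * w)%g} -> k (v^-1)%g = ((k v)^-1)%g.
  by move=> kM; apply/esym/mulg1_eq; rewrite -kM mulgV m1.
elim/freeGroup_ind => [|b w IH|b w IH]; first by rewrite !m1.
  by rewrite h'M HM h'g Hg IH.
by rewrite h'M HM !mV // h'g Hg IH.
Qed.

End FreeGroup.

Notation FZ := (freeGroup int).

(* Main.v *)
Require Import Defs.
From HB Require Import structures.
From mathcomp Require Import all_boot all_order all_algebra.
From mathcomp Require Import boolp.

(** The third axiom says that [Gamma] is a crossed homomorphism: [fun v z =>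
    Gamma z v] is a 1-cocycle of the free group with values in the group of
    families [int -> FZ], on which a word [v] acts by the shift
    [z |-> z + wlength v]. Such cocycles are the same thing as homomorphisms
    [v |-> (fun z => Gamma z v, wlength v)] into the semidirect product of that
    group of families with the shift group [int]. As the source is free, a
    homomorphism of this kind exists for any prescribed values on the
    generators (theorem [shift_cocycle_exists]): send the generator [b] to the
    family [z |-> (z^b)] paired with the shift 1. Conversely a cocycle is
    determined by its values on the generators (lemma [shift_cocycle_unique]),
    by induction on words. *)

Set Implicit Arguments. Unset Strict Implicit. Unset Printing Implicit Defensive.
Import GRing.Theory.
Local Open Scope ring_scope.

(** A record rather than a pair, because multiplication on a product type is
    canonically componentwise, whereas here the shift twists it. *)
Record shiftProd (K : Type) := ShiftProd { family : int -> K; shift : int }.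

HB.instance Definition _ (K : Type) := gen_eqMixin (shiftProd K).
HB.instance Definition _ (K : Type) := gen_choiceMixin (shiftProd K).

Section ShiftProdGroup.
Variable K : groupType.
Implicit Types x y : shiftProd K.

Definition shift_mul x y :=
  ShiftProd (fun z => family x z * family y (z + shift x))%g (shift x + shift y).

Definition shift_one : shiftProd K := ShiftProd (fun=> 1%g) 0.

Definition shift_inv x :=
  ShiftProd (fun z => (family x (z - shift x))^-1)%g (- shift x).

Lemma shiftProd_eq x y :
  (forall z, family x z = family y z) -> shift x = shift y -> x = y.
Proof. by case: x y => f m [g n] /= /funext -> ->. Qed.

Fact shift_mulA : associative shift_mul.
Proof.
by move=> x y w; apply: shiftProd_eq => [z|] /=; rewrite ?mulgA ?addrA.
Qed.

Fact shift_mul1 : left_id shift_one shift_mul.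
Proof.
by move=> x; apply: shiftProd_eq => [z|] /=; rewrite ?mul1g ?addr0 ?add0r.
Qed.

Fact shift_mulr1 : right_id shift_one shift_mul.
Proof. by move=> x; apply: shiftProd_eq => [z|] /=; rewrite ?mulg1 ?addr0. Qed.

Fact shift_mulV : left_inverse shift_one shift_inv shift_mul.
Proof.
by move=> x; apply: shiftProd_eq => [z|] /=; rewrite ?mulVg ?addNr.
Qed.

Fact shift_mulrV : right_inverse shift_one shift_inv shift_mul.
Proof.
by move=> x; apply: shiftProd_eq => [z|] /=; rewrite ?addrK ?mulgV ?subrr.
Qed.

HB.instance Definition _ := isGroup.Build (shiftProd K)
  shift_mulA shift_mul1 shift_mulr1 shift_mulV shift_mulrV.

End ShiftProdGroup.

Section ShiftCocycle.
Variables (T : choiceType) (K : groupType).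
Implicit Types (b : T) (v w : freeGroup T) (z : int).

Definition shift_cocycle (Gamma : int -> freeGroup T -> K) :=
  forall z v w, Gamma z (v * w)%g = (Gamma z v * Gamma (z + wlength v) w)%g.

Lemma wlength_gen b : wlength (gen b) = 1.
Proof. by rewrite wlength_word big_seq1. Qed.

Lemma wlength1 : wlength (1%g : freeGroup T) = 0.
Proof. by rewrite -word_nil wlength_word big_nil. Qed.

Lemma shift_cocycle1 Gamma : shift_cocycle Gamma -> forall z, Gamma z 1%g = 1%g.
Proof.
move=> GM z; apply: (@mulgI _ (Gamma z 1%g)).
by rewrite -{2}[z]addr0 -wlength1 -GM !mulg1.
Qed.

(** In both induction steps the new word and the old one differ by a left
    factor [gen b], so that the cocycle equation for that product determines
    the unknown value, by multiplication or by cancellation. *)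
Lemma shift_cocycle_unique Gamma Gamma' :
  shift_cocycle Gamma -> shift_cocycle Gamma' ->
  (forall z b, Gamma z (gen b) = Gamma' z (gen b)) ->
  forall z w, Gamma z w = Gamma' z w.
Proof.
move=> GM GM' Ggen z w; elim/freeGroup_ind: w z => [|b w IH|b w IH] z.
- by rewrite !shift_cocycle1.
- by rewrite GM GM' Ggen IH.
have [y ->] : exists y, z = y + wlength (gen b).
  by exists (z - 1); rewrite wlength_gen subrK.
apply: (@mulgI _ (Gamma y (gen b))).
by rewrite {2}Ggen -GM -GM' mulVKg.
Qed.

(** The family component of a homomorphism into the semidirect product obeys
    the cocycle equation with the shift component in place of the length; the
    two agree because both are additive and take the value 1 on generators. *)
Theorem shift_cocycle_exists (f : T -> int -> K) :
  exists2 Gamma, shift_cocycle Gamma & forall z b, Gamma z (gen b) = f b z.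
Proof.
have [h [hM hgen _]] := freeGroup_universal (fun b => ShiftProd (f b) 1).
exists (fun z w => family (h w) z) => [z v w|z b]; last by rewrite hgen.
suff <- : shift (h v) = wlength v by rewrite hM.
have shift_gen b u : shift (h (gen b * u)%g) = 1 + shift (h u).
  by rewrite hM hgen.
elim/freeGroup_ind: v => [|b v IH|b v IH].
- apply: (@addrI _ (shift (h 1%g))).
  by rewrite wlength1 addr0 -[in RHS](mulg1 1%g) hM.
- by rewrite shift_gen IH wlengthM wlength_gen.
apply: (@addrI _ 1); rewrite -(shift_gen b).
by rewrite -(wlength_gen b) -wlengthM mulVKg.
Qed.

End ShiftCocycle.

Theorem theorem3p2 :
  exists! Gamma : int -> FZ -> FZ,
    [/\ forall z : int, Gamma z 1%g = 1%g,
        forall z b : int, Gamma z (gen b) = gpow z b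
      & forall (z : int) (v w : FZ),
          Gamma z (v * w)%g = (Gamma z v * Gamma (z + wlength v)%R w)%g].
Proof.
have [Gamma GM Ggen] := shift_cocycle_exists (fun b z : int => gpow z b).
exists Gamma; split=> [|Gamma' [_ Ggen' GM']].
  by split=> //; apply: shift_cocycle1.
apply/funext => z; apply/funext => w; apply: shift_cocycle_unique => // {w}z b.
by rewrite Ggen Ggen'.
Qed.
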